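(* For every integer $n\ge 1$, the Sierpiński gasket graph $S_n$ is Hamiltonian, i.e. it has a cycle passing through every vertex exactly once.
   Context: The Sierpiński gasket graph $S_n$ ($n\ge1$) is the finite simple graph whose vertices are the intersection points of the line segments in the $n$-th finite stage of the Sierpiński gasket and whose edges are the segments joining consecutive such points. Equivalently, it is defined recursively as follows. $S_1$ is a triangle ($K_3$), with its three vertices designated as the top, left and right corner vertices. For $n\ge1$, $S_{n+1}$ is obtained from three disjoint copies $S_{n+1,T}$ (top), $S_{n+1,L}$ (bottom left), $S_{n+1,R}$ (bottom right) of $S_n$ by identifying the left corner of $S_{n+1,T}$ with the top corner of $S_{n+1,L}$, the right corner of $S_{n+1,T}$ with the top corner of $S_{n+1,R}$, and the right corner of $S_{n+1,L}$ with the left corner of $S_{n+1,R}$. The top, left and right corners of $S_{n+1}$ are the top corner of $S_{n+1,T}$, the left corner of $S_{n+1,L}$ and the right corner of $S_{n+1,R}$, respectively. *)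

(* Defs.v *)
From HB Require Import structures.
From mathcomp Require Import all_boot.
From mathcomp Require Import generic_quotient.

Set Implicit Arguments.
Unset Strict Implicit.
Unset Printing Implicit Defensive.

Local Open Scope quotient_scope.

Record sgraph := SGraph {
  vertex :> finType;
  adj : rel vertex;
  adj_sym : symmetric adj;
  adj_irr : irreflexive adj
}.

(* A Hamiltonian cycle, listed without repeating its starting vertex. The
   bound on the size is needed because [cycle] also accepts sequences of
   length at most 2, which are not cycles of a simple graph. *)
Definition hamiltonian (G : sgraph) : Prop :=
  exists c : seq G,
    [/\ 2 < size c, cycle (@adj G) c, uniq c & forall x : G, x \in c].

(* A graph with three distinct corner vertices, indexed by
   0 = top, 1 = left, 2 = right. *)
Record cornered := Cornered {
  cgraph :> sgraph;
  corner : 'I_3 -> cgraph;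
  corner_inj : injective corner
}.

Section Triangle.

Let tadj : rel 'I_3 := fun i j => i != j.

Fact triangle_sym : symmetric tadj.
Proof. by move=> i j; rewrite /tadj eq_sym. Qed.

Fact triangle_irr : irreflexive tadj.
Proof. by move=> i; rewrite /tadj eqxx. Qed.

Definition triangle : cornered :=
  Cornered (cgraph := SGraph triangle_sym triangle_irr) (@inj_id 'I_3).

End Triangle.

Section Glue.

Variable G : cornered.

(* (i, v) is the vertex v of the copy number i of G, with copies numbered like
   corners. The three identifications
     (top, left corner)   ~ (left, top corner),
     (top, right corner)  ~ (right, top corner),
     (left, right corner) ~ (right, left corner)
   are all of the shape (i, corner j) ~ (j, corner i); this is trivial for
   i = j. As corners are distinct, the relation is already transitive. *)
Definition glue_rel (p q : 'I_3 * G) : bool :=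
  (p == q) ||
  [exists i : 'I_3, exists j : 'I_3,
     (p == (i, corner G j)) && (q == (j, corner G i))].

Fact glue_relP p q :
  reflect (p = q \/ exists i j, p = (i, corner G j) /\ q = (j, corner G i))
          (glue_rel p q).
Proof.
apply: (iffP orP) => -[].
- by move/eqP; left.
- by case/existsP=> i /existsP[j /andP[/eqP-> /eqP->]]; right; exists i, j.
- by move/eqP; left.
- case=> i [j [-> ->]]; right.
  by apply/existsP; exists i; apply/existsP; exists j; rewrite !eqxx.
Qed.

Fact glue_rel_refl : reflexive glue_rel.
Proof. by move=> p; rewrite /glue_rel eqxx. Qed.

Fact glue_rel_sym : symmetric glue_rel.
Proof.
suff H p q : glue_rel p q -> glue_rel q p by move=> p q; apply/idP/idP => /H.
by case/glue_relP=> [->|[i [j [-> ->]]]];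
   apply/glue_relP; [left | right; exists j, i].
Qed.

Fact glue_rel_trans : transitive glue_rel.
Proof.
move=> q p r /glue_relP[->//|[i [j [-> ->]]]] /glue_relP[<-|].
  by apply/glue_relP; right; exists i, j.
case=> k [l [[-> /corner_inj ->] ->]].
exact: glue_rel_refl.
Qed.

Canonical glue_equiv :=
  EquivRel glue_rel glue_rel_refl glue_rel_sym glue_rel_trans.

Definition glue_vertex := {eq_quot glue_equiv}.

HB.instance Definition _ := Quotient.on glue_vertex.
HB.instance Definition _ := [Finite of glue_vertex by <:%/].

Definition glue_pi (i : 'I_3) (v : G) : glue_vertex := \pi_glue_vertex (i, v).

Fact glue_piP i j u v :
  reflect (glue_rel (i, u) (j, v)) (glue_pi i u == glue_pi j v).
Proof. by apply: (iffP eqP) => /eqmodP. Qed.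

Fact glue_pi_inj i : injective (glue_pi i).
Proof.
move=> u v /eqP/glue_piP/glue_relP[[]//|].
by case=> k [l [[-> ->] [-> ->]]].
Qed.

Definition glue_adj : rel glue_vertex := fun x y =>
  [exists i : 'I_3, exists u : G, exists v : G,
     [&& x == glue_pi i u, y == glue_pi i v & adj u v]].

Fact glue_adjP x y :
  reflect (exists i u v, [/\ x = glue_pi i u, y = glue_pi i v & adj u v])
          (glue_adj x y).
Proof.
apply: (iffP existsP) => -[i].
  by case/existsP=> u /existsP[v /and3P[/eqP-> /eqP-> uv]]; exists i, u, v.
case=> u [v [-> -> uv]]; exists i; apply/existsP; exists u.
by apply/existsP; exists v; rewrite !eqxx.
Qed.

Fact glue_adj_sym : symmetric glue_adj.
Proof.
suff H x y : glue_adj x y -> glue_adj y x by move=> x y; apply/idP/idP => /H.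
case/glue_adjP=> i [u [v [-> -> uv]]].
by apply/glue_adjP; exists i, v, u; rewrite adj_sym.
Qed.

Fact glue_adj_irr : irreflexive glue_adj.
Proof.
move=> x; apply/glue_adjP => -[i [u [v [-> /glue_pi_inj -> uv]]]].
by rewrite adj_irr in uv.
Qed.

Fact glue_corner_inj : injective (fun i => glue_pi i (corner G i)).
Proof.
move=> i j /eqP/glue_piP/glue_relP[[]//|].
by case=> k [l [[-> /corner_inj ->] [-> _]]].
Qed.

Definition glue : cornered :=
  Cornered
    (cgraph := SGraph (vertex := glue_vertex) glue_adj_sym glue_adj_irr)
    glue_corner_inj.

End Glue.

(* S_n for n >= 1, starting from the triangle S_1; [sierpinski 0] is junk. *)
Definition sierpinski (n : nat) : cornered := iter n.-1 glue triangle.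

(* Main.v *)
(* Induction on n, on the following property of S_n: for any two corners there
   is a path between them through all vertices, and another one through all
   vertices but the third corner. In S_(n+1), a path from corner i to corner j
   is a path of copy i through all its vertices, followed by a path of copy k
   ending at copy j, followed by a path of copy j that skips the vertex shared
   with copy i; the path in copy k decides whether corner k is visited. For the
   Hamiltonian cycle of S_(n+1), join three spanning paths, one in each copy,
   end to end at the three identified vertices. *)
Require Import Defs.
From mathcomp Require Import all_boot.

Set Implicit Arguments.
Unset Strict Implicit.
Unset Printing Implicit Defensive.

Lemma ord3_cover (i j k m : 'I_3) :
  uniq [:: i; j; k] -> [|| m == i, m == j | m == k].
Proof.
move=> u; have : m \in [:: i; j; k]; last by rewrite !inE.
have [||_ ->] := uniq_min_size u (s2 := enum 'I_3).
- by move=> x; rewrite mem_enum.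
- by rewrite size_enum_ord.
by rewrite mem_enum.
Qed.

(** The flag [b] says whether the third corner [k] is visited, so that the two kinds of path are
    built by one and the same induction step. *)
Definition corner_path (G : cornered) (b : bool) (i j k : 'I_3) (p : seq G) :=
  [/\ path (@adj G) (corner G i) p, last (corner G i) p = corner G j,
      uniq (corner G i :: p) &
      forall x, (x \in corner G i :: p) = b || (x != corner G k)].

Definition corner_traceable (G : cornered) :=
  forall b i j k, uniq [:: i; j; k] -> exists p, @corner_path G b i j k p.

(** Concatenation drops the start of a path, so a vertex shared by two copies has to be found as the
    end of the preceding path. *)
Lemma corner_path_end G b i j k p :
  i != j -> @corner_path G b i j k p -> corner G j \in p.
Proof.
move=> ij [_ L _ _]; have := mem_last (corner G i) p; rewrite L inE.
by rewrite (inj_eq (@corner_inj G)) eq_sym (negPf ij).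
Qed.

Lemma triangle_traceable : corner_traceable triangle.
Proof.
move=> b i j k u; have := u; rewrite /= !inE negb_or andbT.
case/andP=> /andP[ij ik] jk.
exists (if b then [:: k; j] else [:: j]); split.
- by case: b; rewrite /= ?ik ?ij //= eq_sym jk.
- by case: b.
- by case: b; rewrite /= !inE ?negb_or ?ij ?ik //= eq_sym jk.
move=> x; case: b; rewrite !inE /=.
  by have := ord3_cover x u; rewrite (orbC (x == k)).
have := ord3_cover x u; have [->|] := eqVneq x i; first by rewrite ik.
by have [->|_] := eqVneq x j; rewrite ?jk //= => _ ->.
Qed.

Section GluePaths.
Variable G : cornered.
Local Notation c := (corner G).
Local Notation pi := (@glue_pi G).

Lemma glue_pi_corner i j : pi i (c j) = pi j (c i).
Proof. by apply/eqP/glue_piP/glue_relP; right; exists i, j. Qed.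

Lemma glue_pi_eq i j u v : i != j -> pi i u = pi j v -> u = c j /\ v = c i.
Proof.
move=> ij /eqP/glue_piP/glue_relP[[e]|]; first by rewrite e eqxx in ij.
by case=> k [l [[-> ->] [-> ->]]].
Qed.

Lemma glue_vertexP (x : glue_vertex G) : exists i v, x = pi i v.
Proof.
by elim/generic_quotient.quotW: x => -[i v]; exists i, v.
Qed.

Lemma glue_path i x p :
  path (@adj G) x p -> path (@glue_adj G) (pi i x) (map (pi i) p).
Proof.
elim: p x => //= y p IHp x /andP[xy /IHp->]; rewrite andbT.
by apply/glue_adjP; exists i, x, y.
Qed.

(** Distinct copies [i] and [j] have only the vertex [pi i (c j) = pi j (c i)] in common, so it is
    enough that one list misses it. *)
Lemma glue_map_disjoint i j (p q : seq G) : i != j ->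
  (c j \notin p) || (c i \notin q) ->
  ~~ has [in map (pi i) p] (map (pi j) q).
Proof.
move=> ij; apply: contraL => /hasP[_ /mapP[v vq ->] /mapP[u up e]].
have [<- <-] := glue_pi_eq ij (esym e).
by rewrite negb_or !negbK up vq.
Qed.

Lemma glue_map_uniq i (p : seq G) : uniq (map (pi i) p) = uniq p.
Proof. by rewrite map_inj_uniq //; apply: glue_pi_inj. Qed.

Lemma glue_mem_map i v (p : seq G) : (pi i v \in map (pi i) p) = (v \in p).
Proof. by rewrite mem_map //; apply: glue_pi_inj. Qed.

Lemma glue_traceable : corner_traceable G -> corner_traceable (glue G).
Proof.
move=> tG b i j k u; have := u; rewrite /= !inE negb_or andbT.
case/andP=> /andP[ij ik] jk.
have [p1 [P1 L1 U1 M1]] : exists p, @corner_path G true i k j p.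
  by apply: tG; rewrite /= !inE negb_or ij ik eq_sym jk.
(* Corner [k] of the gluing is [pi k (c k)], so the path in copy [k] inherits the flag [b]. *)
have [p2 H2] := tG b i j k u; have j2 := corner_path_end ij H2.
have [P2 L2 U2 M2] := H2.
have [p3 [P3 L3 U3 M3]] : exists p, @corner_path G false k j i p.
  by apply: tG; rewrite /= !inE negb_or eq_sym jk eq_sym ik eq_sym ij.
have l1 : last (pi i (c i)) (map (pi i) p1) = pi k (c i).
  by rewrite last_map L1 glue_pi_corner.
have l2 : last (pi k (c i)) (map (pi k) p2) = pi j (c k).
  by rewrite last_map L2 glue_pi_corner.
have i3 : c i \notin p3.
  by have := M3 (c i); rewrite eqxx inE /= => /negbT; rewrite negb_or => /andP[].
exists (map (pi i) p1 ++ map (pi k) p2 ++ map (pi j) p3); split.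
- by rewrite /= !cat_path l1 l2 !glue_path.
- by rewrite /= !last_cat l1 l2 last_map L3.
- change (uniq (map (pi i) (c i :: p1) ++ map (pi k) p2 ++ map (pi j) p3)).
  rewrite !cat_uniq has_cat negb_or !glue_map_uniq U1.
  move: U2 U3; rewrite !cons_uniq => /andP[i2 ->] /andP[k3 ->].
  (* The later list always misses the shared vertex: [p2] and [p3] avoid [c i], and [p3] also avoids
     its dropped start [c k]. *)
  by rewrite !glue_map_disjoint ?i2 ?i3 ?k3 ?orbT // eq_sym.
have in1 v : pi i v \in map (pi i) (c i :: p1) by rewrite glue_mem_map M1.
move=> x.
change ((x \in map (pi i) (c i :: p1) ++ map (pi k) p2 ++ map (pi j) p3)
  = b || (x != pi k (c k))).
rewrite !mem_cat; have [m [v ->]] := glue_vertexP x.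
case/or3P: (ord3_cover m u) => /eqP->.
- rewrite in1; apply/esym/orP; right; apply/eqP=> /(glue_pi_eq ik)[_ e].
  by rewrite (corner_inj e) eqxx in ik.
- have -> : pi j v != pi k (c k).
    apply/eqP=> /(glue_pi_eq jk)[_ e].
    by rewrite (corner_inj e) eqxx in jk.
  rewrite orbT; have [->|vi] := eqVneq v (c i).
    by rewrite glue_pi_corner in1.
  (* In copy [j], the dropped start [c k] of the third path is the end of the second one. *)
  have := M3 v; rewrite vi inE => /orP[/eqP->|v3].
    by rewrite glue_pi_corner [_ \in map (pi k) _]glue_mem_map j2 !orbT.
  by rewrite [_ \in map (pi j) _]glue_mem_map v3 !orbT.
(* In copy [k], [M2] turns the right-hand side into membership in [c i :: p2]. It remains to see
   that the other two blocks add nothing: a common vertex with copy [i] forces [v = c i], and one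
   with copy [j] would be the dropped start of the third path. *)
rewrite (inj_eq (@glue_pi_inj G k)) -M2.
have [->|vi] := eqVneq v (c i); first by rewrite mem_head glue_pi_corner in1.
rewrite [v \in _]in_cons (negPf vi) orFb [_ \in map (pi k) _]glue_mem_map.
apply/or3P/idP => [|v2]; last exact: Or32.
case=> // /mapP[w w_in e].
  have [|v_i _] := glue_pi_eq _ e; first by rewrite eq_sym.
  by rewrite v_i eqxx in vi.
have [|_ w_k] := glue_pi_eq _ e; first by rewrite eq_sym.
by move: U3; rewrite cons_uniq -w_k w_in.
Qed.

Lemma glue_hamiltonian : corner_traceable G -> hamiltonian (glue G).
Proof.
move=> tG; pose t : 'I_3 := inord 0; pose l : 'I_3 := inord 1.
pose r : 'I_3 := inord 2.
have u : uniq [:: t; l; r] by rewrite /= !inE -!val_eqE /= !inordK.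
have := u; rewrite /= !inE negb_or andbT => /andP[/andP[tl tr] lr].
have [p1 H1] : exists p, @corner_path G true l r t p.
  by apply: tG; rewrite /= !inE negb_or lr eq_sym tl eq_sym tr.
have [p2 H2] := tG true t l r u.
have [p3 H3] : exists p, @corner_path G true r t l p.
  by apply: tG; rewrite /= !inE negb_or eq_sym tr eq_sym lr tl.
have e1 := corner_path_end lr H1; have e2 := corner_path_end tl H2.
have e3 : c t \in p3 by apply: corner_path_end H3; rewrite eq_sym.
have [P1 L1 U1 M1] := H1; have [P2 L2 U2 M2] := H2.
have [P3 L3 U3 M3] := H3.
have l1 : last (pi t (c l)) (map (pi t) p1) = pi r (c t).
  by rewrite last_map L1 glue_pi_corner.
have l2 : last (pi r (c t)) (map (pi r) p2) = pi l (c r).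
  by rewrite last_map L2 glue_pi_corner.
have l3 : last (pi l (c r)) (map (pi l) p3) = pi t (c l).
  by rewrite last_map L3 glue_pi_corner.
(* All three starts are dropped, each being the end of the cyclically preceding path. *)
exists (map (pi t) p1 ++ map (pi r) p2 ++ map (pi l) p3); split.
- rewrite !size_cat !size_map.
  by case: (p1) (p2) (p3) e1 e2 e3 => [|? ?] [|? ?] [|? ?] //=; rewrite !addnS.
(* With this default, [l1], [l2] and [l3] compute the last vertex to be [pi t (c l)] again, which
   closes the cycle. *)
- rewrite (cycle_path (pi t (c l))) !last_cat l1 l2 l3 !cat_path l1 l2.
  by rewrite !glue_path.
- move: U1 U2 U3; rewrite !cons_uniq.
  move=> /andP[n1 V1] /andP[n2 V2] /andP[n3 V3].
  rewrite !cat_uniq has_cat negb_or !glue_map_uniq V1 V2 V3.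
  by rewrite !glue_map_disjoint ?n1 ?n2 ?n3 ?orbT // eq_sym.
move=> x; have [m [v ->]] := glue_vertexP x; rewrite !mem_cat.
(* A vertex absent from the block of its own copy is the dropped start of that block, hence the end
   of the preceding one. *)
case/or3P: (ord3_cover m u) => /eqP->.
- have := M1 v; rewrite inE => /orP[/eqP->|v1].
    by rewrite glue_pi_corner [_ \in map (pi l) _]glue_mem_map e3 ?orbT.
  by rewrite glue_mem_map v1.
- have := M3 v; rewrite inE => /orP[/eqP->|v3].
    by rewrite glue_pi_corner [_ \in map (pi r) _]glue_mem_map e2 ?orbT.
  by rewrite [_ \in map (pi l) _]glue_mem_map v3 !orbT.
have := M2 v; rewrite inE => /orP[/eqP->|v2].
  by rewrite glue_pi_corner [_ \in map (pi t) _]glue_mem_map e1 ?orbT.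
by rewrite [_ \in map (pi r) _]glue_mem_map v2 !orbT.
Qed.

End GluePaths.

Lemma triangle_hamiltonian : hamiltonian triangle.
Proof.
exists (enum 'I_3); split; rewrite ?size_enum_ord ?enum_uniq //.
  by rewrite !enum_ordSl enum_ord0.
by move=> x; rewrite mem_enum.
Qed.

Lemma sierpinski_traceable n : corner_traceable (sierpinski n).
Proof.
rewrite /sierpinski; elim: n.-1 => [|m]; first exact: triangle_traceable.
exact: glue_traceable.
Qed.

Theorem theorem4 (n : nat) (hn : 1 <= n) : hamiltonian (sierpinski n).
Proof.
case: n hn => [//|[_|n _]]; first exact: triangle_hamiltonian.
(* [sierpinski n.+2] is by computation [glue (sierpinski n.+1)]. *)
exact: glue_hamiltonian (@sierpinski_traceable n.+1).
Qed.
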